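(* Let $\epsilon\neq0$ be a constant (possibly complex). The point transformation $$x'=e^{t+\frac v2},\qquad t'=t,\qquad u'=\frac{4\epsilon e^{-(v+2t)}}{ux^2},\qquad v'=2(\epsilon\ln x-t)$$ transforms the system $$v'_{x'}=x'u',\qquad v'_{t'}=\epsilon\frac{x'}{u'}u'_{x'}+2(\epsilon-1)$$ to the system $$v_x=ux,\qquad v_t=\frac{x}{u}u_x .$$
   Context: Subscripts denote partial derivatives; $u,v$ are functions of $(x,t)$ and $u',v'$ are functions of $(x',t')$. The second system is the potential form (with potential $v$) of the equation $u_t=\left(\frac{u_x}{u}\right)_x+\frac{1}{xu}u_x$, i.e. of the porous medium equation $u_t=(u^nu_x)_x+\frac{\mu}{x}u^nu_x$ with $n=-1$, $\mu=1$. A point transformation relating $x,t,u,v$ to $x',t',u',v'$ transforms the primed system to the unprimed one if, on substituting the transformation, the primed system becomes an identity by virtue of the unprimed system. Point transformations are assumed non-degenerate. *)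

(* Defs.v *)
From Stdlib Require Import Reals.
From Coquelicot Require Import Coquelicot.

Local Open Scope C_scope.

Definition Cexp (z : C) : C :=
  ((exp (fst z) * cos (snd z))%R, (exp (fst z) * sin (snd z))%R).

(** [L] is a branch of the complex logarithm on the open set [Omega]. *)
Definition log_branch (Omega : C -> Prop) (L : C -> C) : Prop :=
  open Omega /\
  forall z : C, Omega z -> continuous L z /\ Cexp (L z) = z.

(** * Systems of first-order equations for two functions of two variables

    The independent variables range over a field [K], which is [R] or [C] below
    and is embedded in [C] by [inj].  The dependent variables are complex:
    [V] is [C] seen as a normed module over [K], and [val : V -> C] is the
    identity.  Differentiability and derivatives are over [K]. *)

(** Arguments of a system: x, t, u, v, u_x, u_t, v_x, v_t. *)
Definition system : Type := C -> C -> C -> C -> C -> C -> C -> C -> Prop.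

Definition is_partial1 {K : AbsRing} {V : NormedModule K}
    (f : K * K -> V) (p : K * K) (l : V) : Prop :=
  is_derive (fun x : K => f (x, snd p)) (fst p) l.

Definition is_partial2 {K : AbsRing} {V : NormedModule K}
    (f : K * K -> V) (p : K * K) (l : V) : Prop :=
  is_derive (fun t : K => f (fst p, t)) (snd p) l.

Definition differentiable_on {K : AbsRing} {V : NormedModule K}
    (D : K * K -> Prop) (f : K * K -> V) : Prop :=
  forall p : K * K, D p -> ex_filterdiff f (locally p).

Definition satisfies_at {K : AbsRing} {V : NormedModule K}
    (inj : K -> C) (val : V -> C)
    (S : system) (u v : K * K -> V) (p : K * K) : Prop :=
  exists ux ut vx vt : V,
    is_partial1 u p ux /\ is_partial2 u p ut /\
    is_partial1 v p vx /\ is_partial2 v p vt /\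
    S (inj (fst p)) (inj (snd p)) (val (u p)) (val (v p))
      (val ux) (val ut) (val vx) (val vt).

(** * Point transformations *)

(** The space of the variables (x, t, u, v), that is ((x, t), (u, v)). *)
Definition C1 : NormedModule C_AbsRing := AbsRing_NormedModule C_AbsRing.
Definition C2 : NormedModule C_AbsRing := prod_NormedModule C_AbsRing C1 C1.
Definition C4 : NormedModule C_AbsRing := prod_NormedModule C_AbsRing C2 C2.

(** The Jacobian matrix is invertible at every point of [M]. *)
Definition nondegenerate_on (M : C4 -> Prop) (T : C4 -> C4) : Prop :=
  forall q : C4, M q ->
  exists dT : C4 -> C4,
    filterdiff T (locally q) dT /\
    exists inv : C4 -> C4,
      (forall h : C4, inv (dT h) = h) /\ (forall h : C4, dT (inv h) = h).

(** [T], defined on [M], relates the functions (u, v) of (x, t) in [D] to the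
    functions (u', v') of (x', t') in [D']; [phi] is the induced map
    (x, t) |-> (x', t'). *)
Definition related {K : AbsRing} {V : NormedModule K}
    (inj : K -> C) (val : V -> C) (M : C4 -> Prop) (T : C4 -> C4)
    (D : K * K -> Prop) (u v : K * K -> V)
    (D' : K * K -> Prop) (u' v' : K * K -> V)
    (phi : K * K -> K * K) : Prop :=
  forall p : K * K, D p ->
    let q : C4 := ((inj (fst p), inj (snd p)), (val (u p), val (v p))) in
    M q /\ D' (phi p) /\
    T q = ((inj (fst (phi p)), inj (snd (phi p))),
           (val (u' (phi p)), val (v' (phi p)))).

(** Substituting (u', v'), related to (u, v) by [T], into the system [S'] gives
    an identity by virtue of the system [S] for (u, v). *)
Definition transforms_over {K : AbsRing} {V : NormedModule K}
    (inj : K -> C) (val : V -> C)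
    (M : C4 -> Prop) (T : C4 -> C4) (S' S : system) : Prop :=
  forall (D D' : K * K -> Prop) (u v u' v' : K * K -> V)
         (phi : K * K -> K * K),
    open D -> open D' ->
    differentiable_on D u -> differentiable_on D v ->
    differentiable_on D' u' -> differentiable_on D' v' ->
    related inj val M T D u v D' u' v' phi ->
    (forall p : K * K, D p -> satisfies_at inj val S u v p) ->
    forall p : K * K, D p -> satisfies_at inj val S' u' v' (phi p).

Definition transforms_complex : (C4 -> Prop) -> (C4 -> C4) ->
    system -> system -> Prop :=
  @transforms_over C_AbsRing C1 (fun z : C => z) (fun z : C => z).

(** Real independent variables, complex-valued dependent variables. *)
Definition transforms_real : (C4 -> Prop) -> (C4 -> C4) ->
    system -> system -> Prop :=
  @transforms_over R_AbsRing C_R_NormedModule RtoC (fun z : C => z).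

(** The transformation [T] of the open domain [M] maps [S'] to [S]. *)
Definition point_transformation (M : C4 -> Prop) (T : C4 -> C4)
    (S' S : system) : Prop :=
  open M /\ nondegenerate_on M T /\
  transforms_complex M T S' S /\ transforms_real M T S' S.

(** * The two systems and the transformation

    In both systems u occurs in a denominator, hence the condition u <> 0. *)

Definition primed_system (eps : C) : system :=
  fun x t u v ux ut vx vt =>
    u <> RtoC 0 /\
    vx = x * u /\
    vt = eps * (x / u) * ux + RtoC 2 * (eps - RtoC 1).

Definition unprimed_system : system :=
  fun x t u v ux ut vx vt =>
    u <> RtoC 0 /\
    vx = u * x /\
    vt = x / u * ux.

Definition transf (eps : C) (L : C -> C) (q : C4) : C4 :=
  let '((x, t), (u, v)) := q in
  ((Cexp (t + v / RtoC 2), t),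
   (RtoC 4 * eps * Cexp (- (v + RtoC 2 * t)) / (u * (x * x)),
    RtoC 2 * (eps * L x - t))).

(** x lies in the domain of the logarithm (so x <> 0), and u <> 0. *)
Definition transf_domain (Omega : C -> Prop) (q : C4) : Prop :=
  let '((x, t), (u, v)) := q in Omega x /\ u <> RtoC 0.

(* Main.v *)
Require Import Defs.
From Stdlib Require Import Reals Lra.
From Coquelicot Require Import Coquelicot.

(** The pair (u', v') is a function of (x', t') only through the graph of
    (u, v): the curve y |-> (x, t, u, v) over a coordinate line of the (x, t)
    plane is carried by the transformation to a curve on the graph of (u', v').
    Differentiating that curve in two ways, by the chain rule for the
    transformation and by the chain rule for u' and v' along (x', t'), and using
    uniqueness of derivatives, gives linear equations for the partial
    derivatives of u' and v' ([related_derivatives]).  With X and U the values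
    of x' and u' and with x'_x = X v_x / 2, x'_t = X (1 + v_t / 2), t'_x = 0 and
    t'_t = 1, they read

      - U (v_x + u_x / u + 2 / x) = u'_x' X v_x / 2,
      2 eps / x = v'_x' X v_x / 2,
      - 2 = v'_x' X (1 + v_t / 2) + v'_t'.

    By v_x = u x and v_t = x u_x / u, and since X X e^(-(v + 2 t)) = 1, solving
    them gives the primed system; this is [primed_from_unprimed].  It is
    essential that v_x does not vanish, that is u x <> 0.

    One argument serves for real and for complex independent variables, through
    a notion of derivative of a curve in a complex normed module whose parameter
    runs over R or C ([curve_derivative]).  In particular x' and t', as functions
    of (x, t), are differentiated as functions with values in C.

    The transformation itself is differentiated over C, which requires that the
    exponential is holomorphic ([is_derive_Cexp]) and that any continuous branch
    of the logarithm is holomorphic with derivative 1 / z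
    ([is_derive_log_branch]).  Its differential is inverted explicitly
    ([nondegenerate_transf]). *)

Local Open Scope C_scope.

(** C over itself, with the neighbourhoods given by the modulus.  The module
    structure inferred for C is another one, whose uniform structure is that of
    the plane; [locally_C] relates the neighbourhoods of the two. *)
Local Notation CV := (AbsRing_NormedModule C_AbsRing).

(** * Norms and derivatives *)

Lemma norm_pair_le {K : AbsRing} {U V : NormedModule K} (x : U) (y : V) (r : R) :
  (norm x <= r -> norm y <= r -> norm (x, y) <= 2 * r)%R.
Proof.
  intros Hx Hy; apply (Rle_trans _ _ _ (proj2 (norm_prod x y))).
  assert (Hs2 : (sqrt 2 <= 2)%R).
  { rewrite <- (sqrt_Rsqr 2) at 2 by lra; apply sqrt_le_1_alt; unfold Rsqr; lra. }
  apply Rmult_le_compat; [apply sqrt_pos | | exact Hs2 | apply Rmax_lub; assumption].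
  exact (Rle_trans _ _ _ (norm_ge_0 x) (Rmax_l _ _)).
Qed.

Lemma Cmod_pair_le (a b r : R) :
  (Rabs a <= r -> Rabs b <= r -> Cmod (a, b) <= 2 * r)%R.
Proof.
  rewrite Cmod_norm; exact (norm_pair_le (U := R_NormedModule) (V := R_NormedModule) a b r).
Qed.

Lemma RtoC_neq_0 (r : R) : r <> 0%R -> RtoC r <> RtoC 0.
Proof. intros Hr H; exact (Hr (RtoC_inj _ _ H)). Qed.

(** Strips the quantification over limits of the neighbourhood filter: in a
    normed module the limit is unique. *)
Lemma is_derive_iff {K : AbsRing} {V : NormedModule K} (f : K -> V) (x : K) (l : V) :
  is_derive f x l <->
  (forall e : posreal, locally x (fun y : K =>
     norm (minus (minus (f y) (f x)) (scal (minus y x) l)) <= e * abs (minus y x))%R).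
Proof.
  split.
  - intros [_ H] e; exact (H x (fun P HP => HP) e).
  - intros H; split; [exact (is_linear_scal_l l)|].
    intros x' Hx' e.
    rewrite <- (is_filter_lim_locally_unique (V := AbsRing_NormedModule K) x x' Hx').
    exact (H e).
Qed.

Lemma filterdiff_domin {K : AbsRing} {U V : NormedModule K} (f : U -> V) (x : U) (lf : U -> V) :
  filterdiff f (locally x) lf ->
  forall e : posreal, locally x (fun y =>
    norm (minus (minus (f y) (f x)) (lf (minus y x))) <= e * norm (minus y x))%R.
Proof. intros [_ H]; exact (H x (fun P HP => HP)). Qed.

Lemma filterdiff_pair {K : AbsRing} {T U V : NormedModule K}
    (f : T -> U) (g : T -> V) (x : T) (lf : T -> U) (lg : T -> V) :
  filterdiff f (locally x) lf -> filterdiff g (locally x) lg ->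
  filterdiff (V := prod_NormedModule K U V) (fun y => (f y, g y)) (locally x)
    (fun y => (lf y, lg y)).
Proof.
  intros Hf Hg.
  apply (filterdiff_comp'_2 (W := prod_NormedModule K U V) f g pair x lf lg pair Hf Hg).
  apply (filterdiff_linear (V := prod_NormedModule K U V) (fun t : U * V => (fst t, snd t))).
  exact (is_linear_prod _ _ is_linear_fst is_linear_snd).
Qed.

Lemma filterdiff_partial1 {K : AbsRing} {V : NormedModule K} (f : K * K -> V) (p : K * K)
    (lf : K * K -> V) :
  filterdiff (U := prod_NormedModule K (AbsRing_NormedModule K) (AbsRing_NormedModule K))
    f (locally p) lf ->
  is_partial1 f p (lf (one, zero)).
Proof.
  intros Hf; destruct p as [x t].
  assert (H := filterdiff_comp' (fun y : K => (y, t)) f x _ lf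
    (filterdiff_pair (U := AbsRing_NormedModule K) (V := AbsRing_NormedModule K) _ _ x _ _
       (filterdiff_id _) (filterdiff_const t)) Hf).
  refine (filterdiff_ext_lin _ _ _ H _); intros k.
  rewrite <- (linear_scal lf (proj1 Hf)); f_equal.
  exact (f_equal2 pair (eq_sym (mult_one_r k)) (eq_sym (mult_zero_r k))).
Qed.

Lemma filterdiff_partial2 {K : AbsRing} {V : NormedModule K} (f : K * K -> V) (p : K * K)
    (lf : K * K -> V) :
  filterdiff (U := prod_NormedModule K (AbsRing_NormedModule K) (AbsRing_NormedModule K))
    f (locally p) lf ->
  is_partial2 f p (lf (zero, one)).
Proof.
  intros Hf; destruct p as [x t].
  assert (H := filterdiff_comp' (fun y : K => (x, y)) f t _ lf
    (filterdiff_pair (U := AbsRing_NormedModule K) (V := AbsRing_NormedModule K) _ _ t _ _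
       (filterdiff_const x) (filterdiff_id _)) Hf).
  refine (filterdiff_ext_lin _ _ _ H _); intros k.
  rewrite <- (linear_scal lf (proj1 Hf)); f_equal.
  exact (f_equal2 pair (eq_sym (mult_zero_r k)) (eq_sym (mult_one_r k))).
Qed.

(** * The complex exponential, inverse and logarithm *)

Lemma is_derive_C_iff (f : C -> C) (x l : C) :
  is_derive (f : C_AbsRing -> CV) x l <->
  (forall e : posreal, exists d : posreal, forall y : C,
     (Cmod (y - x) < d -> Cmod (f y - f x - (y - x) * l) <= e * Cmod (y - x))%R).
Proof.
  exact (is_derive_iff (K := C_AbsRing) (V := CV) f x l).
Qed.

Lemma Cexp_plus (z w : C) : Cexp (z + w) = Cexp z * Cexp w.
Proof.
  unfold Cexp, Cmult, Cplus; simpl.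
  rewrite exp_plus, cos_plus, sin_plus; f_equal; ring.
Qed.

Lemma Cexp_0 : Cexp (RtoC 0) = RtoC 1.
Proof.
  unfold Cexp, RtoC; simpl; rewrite exp_0, cos_0, sin_0; f_equal; ring.
Qed.

Lemma Cexp_neq_0 (z : C) : Cexp z <> RtoC 0.
Proof.
  intros H; apply C1_nz.
  rewrite <- Cexp_0, <- (Cplus_opp_r z), Cexp_plus, H; ring.
Qed.

Lemma derive_small (f : R -> R) (l : R) :
  derivable_pt_lim f 0 l ->
  forall e : R, (0 < e)%R -> exists d : posreal, forall h : R, (Rabs h < d ->
    Rabs (f h - f 0 - l * h) <= e * Rabs h)%R.
Proof.
  intros H e He; destruct (H e He) as [d Hd]; exists d; intros h Hh.
  destruct (Req_dec h 0) as [->|Hn].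
  { rewrite Rminus_diag, Rmult_0_r, Rminus_0_r, Rabs_R0; lra. }
  specialize (Hd h Hn Hh); rewrite Rplus_0_l in Hd.
  replace (f h - f 0 - l * h)%R with (((f h - f 0) / h - l) * h)%R by (field; exact Hn).
  rewrite Rabs_mult; apply Rmult_le_compat_r; [apply Rabs_pos | lra].
Qed.

(** With exp a = 1 + a + r1, cos b = 1 + r2 and sin b = b + r3, the real and the
    imaginary part of e^(a + i b) - 1 - (a + i b) are r1 cos b + (1 + a) r2 and
    (a + r1) sin b + r3, and r1, r2, r3 are o(|a + i b|). *)
Lemma is_derive_Cexp_0 : is_derive (Cexp : C_AbsRing -> CV) (RtoC 0) (RtoC 1).
Proof.
  apply is_derive_C_iff; intros e.
  (* Both parts are bounded by 5 k m, where k bounds the relative size of the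
     remainders and m is the modulus of the argument. *)
  set (k := Rmin 1 (e / 10)%R).
  assert (Hk : (0 < k)%R) by (unfold k; apply Rmin_glb_lt; [lra | pose proof (cond_pos e); lra]).
  assert (Hk1 : (k <= 1)%R) by apply Rmin_l.
  assert (Hk2 : (10 * k <= e)%R) by (assert (H := Rmin_r 1 (e / 10)); fold k in H; lra).
  destruct (derive_small exp 1 derivable_pt_lim_exp_0 k Hk) as [d1 H1].
  assert (H2 := derivable_pt_lim_cos 0); rewrite sin_0, Ropp_0 in H2.
  destruct (derive_small cos 0 H2 k Hk) as [d2 H2'].
  assert (H3 := derivable_pt_lim_sin 0); rewrite cos_0 in H3.
  destruct (derive_small sin 1 H3 k Hk) as [d3 H3'].
  assert (Hd : (0 < Rmin (Rmin d1 d2) (Rmin d3 k))%R).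
  { apply Rmin_glb_lt; apply Rmin_glb_lt; try apply cond_pos; exact Hk. }
  exists (mkposreal _ Hd); intros [a b]; simpl.
  intros Hy.
  rewrite Cexp_0.
  replace ((a, b) - RtoC 0) with ((a, b) : C) in * by (unfold RtoC, Cminus, Cplus, Copp; simpl; f_equal; ring).
  assert (Hab := Rmax_Cmod (a, b)); simpl in Hab.
  set (m := Cmod (a, b)) in *.
  assert (Ha : (Rabs a <= m)%R) by (eapply Rle_trans; [apply Rmax_l | exact Hab]).
  assert (Hb : (Rabs b <= m)%R) by (eapply Rle_trans; [apply Rmax_r | exact Hab]).
  assert (Hm : (m < d1 /\ m < d2 /\ m < d3 /\ m < k)%R).
  { apply Rmin_Rgt in Hy as [Hy1 Hy2]; apply Rmin_Rgt in Hy1; apply Rmin_Rgt in Hy2; tauto. }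
  destruct Hm as (Hm1 & Hm2 & Hm3 & Hmk).
  specialize (H1 a ltac:(lra)). specialize (H2' b ltac:(lra)). specialize (H3' b ltac:(lra)).
  rewrite exp_0 in H1; rewrite cos_0 in H2'; rewrite sin_0 in H3'.
  replace (Cexp (a, b) - RtoC 1 - (a, b) * RtoC 1)
    with ((exp a * cos b - 1 - a, exp a * sin b - b)%R : C)
    by (unfold Cexp, RtoC, Cminus, Cplus, Copp, Cmult; simpl; f_equal; ring).
  assert (Hmm := Cmod_ge_0 (a, b)); fold m in Hmm.
  replace (e * m)%R with (2 * (e / 2 * m))%R by field.
  enough (Hr : (Rabs (exp a * cos b - 1 - a) <= 5 * k * m /\
                Rabs (exp a * sin b - b) <= 5 * k * m)%R).
  { assert (Hke : (5 * k * m <= e / 2 * m)%R) by (apply Rmult_le_compat_r; lra).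
    apply Cmod_pair_le; eapply Rle_trans; try exact Hke; apply Hr. }
  set (r1 := (exp a - 1 - 1 * a)%R) in *.
  set (r2 := (cos b - 1 - 0 * b)%R) in *.
  set (r3 := (sin b - 0 - 1 * b)%R) in *.
  assert (E1 : exp a = (1 + a + r1)%R) by (unfold r1; ring).
  assert (E2 : cos b = (1 + r2)%R) by (unfold r2; ring).
  assert (E3 : sin b = (b + r3)%R) by (unfold r3; ring).
  assert (Hkm : (k * m <= m)%R) by nra.
  assert (Hkm0 : (0 <= k * m)%R) by nra.
  assert (Hr1 : (Rabs r1 <= k * m)%R) by (eapply Rle_trans; [exact H1|]; apply Rmult_le_compat_l; lra).
  assert (Hr2 : (Rabs r2 <= k * m)%R) by (eapply Rle_trans; [exact H2'|]; apply Rmult_le_compat_l; lra).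
  assert (Hr3 : (Rabs r3 <= k * m)%R) by (eapply Rle_trans; [exact H3'|]; apply Rmult_le_compat_l; lra).
  assert (Hc : (Rabs (1 + a) <= 2)%R).
  { eapply Rle_trans; [apply Rabs_triang|]; rewrite Rabs_R1; lra. }
  assert (Hc' := Rabs_pos (1 + a)).
  assert (Hcos : (Rabs (cos b) <= 1)%R) by (apply Rabs_le, COS_bound).
  assert (Hsin : (Rabs (sin b) <= 2 * m)%R).
  { rewrite E3; eapply Rle_trans; [apply Rabs_triang|]; lra. }
  split.
  - replace (exp a * cos b - 1 - a)%R with (r1 * cos b + (1 + a) * r2)%R
      by (rewrite E1; rewrite E2; ring).
    eapply Rle_trans; [apply Rabs_triang|]; rewrite !Rabs_mult.
    assert (Rabs r1 * Rabs (cos b) <= k * m * 1)%R by (apply Rmult_le_compat; try apply Rabs_pos; assumption).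
    assert (Rabs (1 + a) * Rabs r2 <= 2 * (k * m))%R by (apply Rmult_le_compat; try apply Rabs_pos; assumption).
    lra.
  - replace (exp a * sin b - b)%R with ((a + r1) * sin b + r3)%R
      by (rewrite E1; rewrite E3; ring).
    eapply Rle_trans; [apply Rabs_triang|]; rewrite !Rabs_mult.
    assert (H : (Rabs (a + r1) <= 2 * m)%R) by (eapply Rle_trans; [apply Rabs_triang|]; lra).
    assert (Rabs (a + r1) * Rabs (sin b) <= 2 * m * (2 * m))%R by (apply Rmult_le_compat; try apply Rabs_pos; assumption).
    assert (m * m <= k * m)%R by nra.
    lra.
Qed.

Lemma is_derive_Cexp (z : C) : is_derive (Cexp : C_AbsRing -> CV) z (Cexp z).
Proof.
  apply is_derive_C_iff; intros e.
  assert (Hz : (0 < Cmod (Cexp z))%R) by (apply Cmod_gt_0, Cexp_neq_0).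
  assert (He : (0 < e / Cmod (Cexp z))%R) by (apply Rdiv_lt_0_compat; [apply cond_pos | exact Hz]).
  destruct (proj1 (is_derive_C_iff _ _ _) is_derive_Cexp_0 (mkposreal _ He)) as [d Hd].
  exists d; intros y Hy; specialize (Hd (y - z)); simpl in Hd.
  replace (y - z - RtoC 0) with (y - z) in Hd by ring; specialize (Hd Hy).
  rewrite Cexp_0 in Hd.
  replace (Cexp y - Cexp z - (y - z) * Cexp z)
    with (Cexp z * (Cexp (y - z) - RtoC 1 - (y - z) * RtoC 1)).
  2: { replace (Cexp y) with (Cexp z * Cexp (y - z)) by (rewrite <- Cexp_plus; f_equal; ring). ring. }
  rewrite Cmod_mult.
  eapply Rle_trans; [apply Rmult_le_compat_l; [apply Rlt_le, Hz | exact Hd]|].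
  apply Req_le; field; lra.
Qed.

Lemma is_derive_Cinv (z : C) :
  z <> RtoC 0 -> is_derive (Cinv : C_AbsRing -> CV) z (- (/ z * / z)).
Proof.
  intros Hz; apply is_derive_C_iff; intros e.
  assert (Hm : (0 < Cmod z)%R) by (apply Cmod_gt_0, Hz).
  set (m := Cmod z) in *.
  assert (Hd : (0 < Rmin (m / 2) (e * m * m * m / 2))%R).
  { pose proof (cond_pos e); apply Rmin_glb_lt; [lra|].
    apply Rdiv_lt_0_compat; [|lra]; repeat apply Rmult_lt_0_compat; assumption. }
  exists (mkposreal _ Hd); intros y Hy; simpl in Hy.
  apply Rmin_Rgt in Hy as [Hy1 Hy2].
  assert (Hmy : (m / 2 < Cmod y)%R).
  { assert (H := Cmod_triangle y (z - y)).
    replace (y + (z - y)) with z in H by ring.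
    replace (z - y) with (- (y - z)) in H by ring; rewrite Cmod_opp in H; fold m in H; lra. }
  assert (Hy0 : y <> RtoC 0) by (apply Cmod_gt_0; lra).
  replace (/ y - / z - (y - z) * - (/ z * / z))
    with ((y - z) * ((y - z) * (/ y * (/ z * / z)))) by (field; split; assumption).
  rewrite !Cmod_mult, !Cmod_inv by assumption; fold m.
  rewrite (Rmult_comm e); apply Rmult_le_compat_l; [apply Cmod_ge_0|].
  apply Rmult_le_reg_r with (Cmod y * (m * m))%R.
  { repeat apply Rmult_lt_0_compat; lra. }
  replace (Cmod (y - z) * (/ Cmod y * (/ m * / m)) * (Cmod y * (m * m)))%R
    with (Cmod (y - z)) by (field; split; lra).
  pose proof (cond_pos e).
  assert (0 < e * (m * m))%R by (repeat apply Rmult_lt_0_compat; lra).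
  apply Rlt_le, (Rlt_le_trans _ _ _ Hy2); nra.
Qed.

(** Put h = L y - L z, which tends to 0 by continuity.  Then e^h - 1 = (y - z) / z
    while e^h - 1 = h + o(h).  So h = O(y - z), and the error o(h) is o(y - z). *)
Lemma is_derive_log_branch (Omega : C -> Prop) (L : C -> C) (z : C) :
  log_branch Omega L -> Omega z ->
  z <> RtoC 0 /\ is_derive (L : C_AbsRing -> CV) z (/ z).
Proof.
  intros [HO HL] Hz; destruct (HL z Hz) as [Hc He].
  assert (Hz0 : z <> RtoC 0) by (rewrite <- He; apply Cexp_neq_0).
  split; [exact Hz0|].
  assert (Hm : (0 < Cmod z)%R) by (apply Cmod_gt_0, Hz0).
  apply is_derive_C_iff; intros e.
  (* The bound 1/2 on the relative error gives |h| <= 2 |(y - z) / z|; the other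
     bound turns k |h| into e |y - z|. *)
  set (k := Rmin (1 / 2) (e * Cmod z / 2)%R).
  assert (Hk : (0 < k)%R).
  { pose proof (cond_pos e); apply Rmin_glb_lt; [lra|].
    apply Rdiv_lt_0_compat; [apply Rmult_lt_0_compat|]; lra. }
  destruct (proj1 (is_derive_C_iff _ _ _) is_derive_Cexp_0 (mkposreal _ Hk)) as [d Hd].
  assert (Hloc : locally (T := AbsRing_UniformSpace C_AbsRing) z
      (fun y => Omega y /\ Cmod (L y - L z) < d)%R).
  { apply locally_C, filter_and; [exact (HO z Hz)|].
    apply (Hc (fun w => Cmod (w - L z) < d)%R).
    apply locally_C; exists d; intros w Hw; exact Hw. }
  destruct Hloc as [r Hr]; exists r; intros y Hy.
  destruct (Hr y Hy) as [Hy1 Hy2].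
  specialize (Hd (L y - L z)); simpl in Hd.
  replace (L y - L z - RtoC 0) with (L y - L z) in Hd by ring.
  specialize (Hd Hy2).
  set (h := L y - L z) in *.
  assert (Eh : Cexp h = y / z).
  { rewrite <- (proj2 (HL y Hy1)). rewrite <- He.
    replace (Cexp (L y)) with (Cexp h * Cexp (L z)); [field; apply Cexp_neq_0|].
    rewrite <- Cexp_plus; f_equal; unfold h; ring. }
  rewrite Eh, Cexp_0 in Hd.
  set (q := (y - z) / z).
  replace (y / z - RtoC 1 - h * RtoC 1) with (q - h) in Hd by (unfold q; field; exact Hz0).
  replace (h - (y - z) * / z) with (- (q - h)) by (unfold q; field; exact Hz0).
  rewrite Cmod_opp.
  assert (Eq : (Cmod (y - z) = Cmod q * Cmod z)%R).
  { rewrite <- Cmod_mult; f_equal; unfold q; field; exact Hz0. }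
  assert (Hk1 : (k <= 1 / 2)%R) by apply Rmin_l.
  assert (Hk2 : (k <= e * Cmod z / 2)%R) by apply Rmin_r.
  assert (Hh : (Cmod h <= Cmod q + Cmod (q - h))%R).
  { assert (H := Cmod_triangle q (- (q - h))).
    rewrite Cmod_opp in H; replace (q + - (q - h)) with h in H by ring; exact H. }
  assert (H0 := Cmod_ge_0 h); assert (H1 := Cmod_ge_0 q).
  assert (Hh2 : (Cmod h <= 2 * Cmod q)%R) by nra.
  rewrite Eq; apply (Rle_trans _ _ _ Hd).
  apply Rle_trans with (k * (2 * Cmod q))%R; [apply Rmult_le_compat_l; lra|].
  nra.
Qed.

(** * Complex differential of the transformation *)

(** The algebra tactics need the carrier C, not a convertible module carrier, as
    the type of the equation. *)
Ltac as_complex := lazymatch goal with |- @eq _ ?a ?b => change (@eq C a b) end.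

Section Complex_differentials.
Context {U : NormedModule C_AbsRing} (x : U).
Notation differential f l := (filterdiff (V := CV) f (locally x) l).

Lemma filterdiff_Cplus (f g lf lg : U -> C) :
  differential f lf -> differential g lg ->
  differential (fun y => f y + g y) (fun h => lf h + lg h).
Proof. exact (filterdiff_plus_fct (V := CV) f g lf lg). Qed.

Lemma filterdiff_Cmult (f g lf lg : U -> C) :
  differential f lf -> differential g lg ->
  differential (fun y => f y * g y) (fun h => lf h * g x + f x * lg h).
Proof. exact (filterdiff_mult_fct (K := C_AbsRing) f g x lf lg Cmult_comm). Qed.

Lemma filterdiff_Cconst (c : C) : differential (fun _ => c) (fun _ => RtoC 0).
Proof. exact (filterdiff_const (V := CV) c). Qed.

Lemma filterdiff_Ccomp (g : C -> C) (m : C) (f lf : U -> C) :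
  is_derive (g : C_AbsRing -> CV) (f x) m -> differential f lf ->
  differential (fun y => g (f y)) (fun h => lf h * m).
Proof.
  intros Hg Hf.
  exact (filterdiff_comp' (V := CV) (W := CV) f g x lf _ Hf Hg).
Qed.
End Complex_differentials.

Definition transf_differential (eps : C) (q h : C4) : C4 :=
  let '((x, t), (u, v)) := q in
  let '((dx, dt), (du, dv)) := h in
  ((Cexp (t + v / RtoC 2) * (dt + dv / RtoC 2), dt),
   (- (RtoC 4 * eps * Cexp (- (v + RtoC 2 * t)) / (u * (x * x)))
      * (dv + RtoC 2 * dt + du / u + RtoC 2 * dx / x),
    RtoC 2 * (eps * dx / x - dt))).

Lemma filterdiff_transf (eps : C) (Omega : C -> Prop) (L : C -> C) (q : C4) :
  log_branch Omega L -> transf_domain Omega q ->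
  filterdiff (transf eps L) (locally q) (transf_differential eps q).
Proof.
  destruct q as [[x t] [u v]]; intros HL [Hx Hu].
  destruct (is_derive_log_branch _ _ _ HL Hx) as [Hx0 HLx].
  set (q := ((x, t), (u, v)) : C4).
  assert (Dx : filterdiff (U := C4) (V := CV) (fun p => fst (fst p)) (locally q) (fun p => fst (fst p))).
  { apply filterdiff_linear, (is_linear_comp (V := C2)); exact is_linear_fst. }
  assert (Dt : filterdiff (U := C4) (V := CV) (fun p => snd (fst p)) (locally q) (fun p => snd (fst p))).
  { apply filterdiff_linear, (is_linear_comp (V := C2)); [exact is_linear_fst | exact is_linear_snd]. }
  assert (Du : filterdiff (U := C4) (V := CV) (fun p => fst (snd p)) (locally q) (fun p => fst (snd p))).
  { apply filterdiff_linear, (is_linear_comp (V := C2)); [exact is_linear_snd | exact is_linear_fst]. }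
  assert (Dv : filterdiff (U := C4) (V := CV) (fun p => snd (snd p)) (locally q) (fun p => snd (snd p))).
  { apply filterdiff_linear, (is_linear_comp (V := C2)); exact is_linear_snd. }
  assert (Hd : u * (x * x) <> RtoC 0) by (repeat apply Cmult_neq_0; assumption).
  assert (DX := filterdiff_Ccomp q Cexp _ _ _ (is_derive_Cexp _)
    (filterdiff_Cplus q _ _ _ _ Dt (filterdiff_Cmult q _ _ _ _ Dv (filterdiff_Cconst q (/ RtoC 2))))).
  assert (DE := filterdiff_Ccomp q Cexp _ _ _ (is_derive_Cexp _)
    (filterdiff_Cmult q _ _ _ _ (filterdiff_Cconst q (- RtoC 1))
      (filterdiff_Cplus q _ _ _ _ Dv
        (filterdiff_Cmult q _ _ _ _ (filterdiff_Cconst q (RtoC 2)) Dt)))).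
  assert (DI := filterdiff_Ccomp q Cinv _ _ _ (is_derive_Cinv _ Hd)
    (filterdiff_Cmult q _ _ _ _ Du (filterdiff_Cmult q _ _ _ _ Dx Dx))).
  assert (DU := filterdiff_Cmult q _ _ _ _
    (filterdiff_Cmult q _ _ _ _ (filterdiff_Cconst q (RtoC 4 * eps)) DE) DI).
  assert (DL := filterdiff_Ccomp q L _ _ _ HLx Dx).
  assert (DV := filterdiff_Cmult q _ _ _ _ (filterdiff_Cconst q (RtoC 2))
    (filterdiff_Cplus q _ _ _ _
      (filterdiff_Cmult q _ _ _ _ (filterdiff_Cconst q eps) DL)
      (filterdiff_Cmult q _ _ _ _ (filterdiff_Cconst q (- RtoC 1)) Dt))).
  assert (D := filterdiff_pair _ _ q _ _ (filterdiff_pair _ _ q _ _ DX Dt) (filterdiff_pair _ _ q _ _ DU DV)).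
  cbv beta in D; simpl fst in D; simpl snd in D.
  eapply filterdiff_ext_lin; [eapply filterdiff_ext; [|exact D]|].
  - intros [[x' t'] [u' v']]; simpl.
    replace (- RtoC 1 * (v' + RtoC 2 * t')) with (- (v' + RtoC 2 * t')) by ring.
    unfold Cdiv; apply f_equal2; apply f_equal2; as_complex; first [reflexivity | ring].
  - intros [[dx dt] [du dv]]; simpl.
    replace (- RtoC 1 * (v + RtoC 2 * t)) with (- (v + RtoC 2 * t)) by ring.
    replace (t + v * / RtoC 2) with (t + v / RtoC 2) by reflexivity.
    assert (H2 : RtoC 2 <> RtoC 0) by (apply RtoC_neq_0; lra).
    apply f_equal2; apply f_equal2; as_complex; first [reflexivity | field]; repeat split; assumption.
Qed.

Lemma nondegenerate_transf (eps : C) (Omega : C -> Prop) (L : C -> C) :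
  eps <> RtoC 0 -> log_branch Omega L ->
  nondegenerate_on (transf_domain Omega) (transf eps L).
Proof.
  intros He HL q Hq; exists (transf_differential eps q).
  split; [exact (filterdiff_transf eps Omega L q HL Hq)|].
  destruct q as [[x t] [u v]]; destruct Hq as [Hx Hu].
  destruct (is_derive_log_branch _ _ _ HL Hx) as [Hx0 _].
  set (X := Cexp (t + v / RtoC 2)).
  set (E := Cexp (- (v + RtoC 2 * t))).
  assert (HX : X <> RtoC 0) by apply Cexp_neq_0.
  assert (HE : E <> RtoC 0) by apply Cexp_neq_0.
  assert (H2 : RtoC 2 <> RtoC 0) by (apply RtoC_neq_0; lra).
  assert (H4 : RtoC 4 <> RtoC 0) by (apply RtoC_neq_0; lra).
  (* The differential determines dt from t', dv from x' and dt, dx from v' and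
     dt, and finally du from u' and the rest. *)
  exists (fun h : C4 =>
    let '((a, b), (c, d)) := h in
    let dx := x / eps * (d / RtoC 2 + b) in
    let dv := RtoC 2 * (a / X - b) in
    ((dx, b),
     (- u * (c * (u * (x * x)) / (RtoC 4 * eps * E) + dv + RtoC 2 * b + RtoC 2 * dx / x), dv))).
  split; intros [[a b] [c d]]; unfold transf_differential; fold X E; cbv beta iota zeta;
    apply f_equal2; apply f_equal2; as_complex; first [reflexivity | field]; repeat split; assumption.
Qed.

Lemma open_transf_domain (Omega : C -> Prop) (L : C -> C) :
  log_branch Omega L -> open (transf_domain Omega : C4 -> Prop).
Proof.
  intros [HO _].
  apply (open_ext (T := C4) (fun q => Omega (fst (fst q)) /\ fst (snd q) <> RtoC 0)).
  { intros [[x t] [u v]]; reflexivity. }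
  apply (open_and (T := C4)).
  - apply (open_comp (T := C4) (U := CV) (fun q => fst (fst q)) Omega).
    + intros q _; apply (linear_cont (U := C4) (V := CV)).
      apply (is_linear_comp (V := C2)); exact is_linear_fst.
    + intros z Hz; apply locally_C, HO, Hz.
  - apply (open_comp (T := C4) (U := CV) (fun q => fst (snd q)) (fun z => z <> RtoC 0)).
    + intros q _; apply (linear_cont (U := C4) (V := CV)).
      apply (is_linear_comp (V := C2)); [exact is_linear_snd | exact is_linear_fst].
    + intros z Hz.
      exists (mkposreal _ (proj1 (Cmod_gt_0 z) Hz)); intros y Hy Hy0.
      assert (H : (Cmod (y - z) < Cmod z)%R) by exact Hy.
      rewrite Hy0 in H.
      replace (RtoC 0 - z) with (- z) in H by ring; rewrite Cmod_opp in H; lra.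
Qed.

(** * Curves over the field of independent variables *)

(** What the pairs (R, C as a real space) and (C, C) have in common: [inj] embeds
    the scalars isometrically in C, and [val] is an isometric identification of
    [V] with a space of complex numbers on which scalars act through [inj]. *)
Record scalar_extension {K : AbsRing} {V : NormedModule K} (inj : K -> C) (val : V -> C) : Prop := {
  inj_minus : forall k l : K, inj (minus k l) = inj k - inj l;
  Cmod_inj : forall k : K, Cmod (inj k) = abs k;
  (* Excludes discrete scalars, over which derivatives would not be unique. *)
  small_scalar : forall e : posreal, exists k : K, (0 < abs k < e)%R;
  val_plus : forall a b : V, val (plus a b) = val a + val b;
  val_opp : forall a : V, val (opp a) = - val a;
  val_scal : forall (k : K) (a : V), val (scal k a) = inj k * val a;
  Cmod_val : forall a : V, Cmod (val a) = norm a
}.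

Lemma scalar_extension_C :
  scalar_extension (K := C_AbsRing) (V := CV) (fun z : C => z) (fun z : C => z).
Proof.
  split; try reflexivity.
  intros e; exists (RtoC (e / 2)).
  change (0 < Cmod (RtoC (e / 2)) < e)%R.
  pose proof (cond_pos e); rewrite Cmod_R, Rabs_pos_eq; lra.
Qed.

Lemma scalar_extension_R :
  scalar_extension (K := R_AbsRing) (V := C_R_NormedModule) RtoC (fun z : C => z).
Proof.
  split; try reflexivity.
  - intros k l; exact (RtoC_minus k l).
  - exact Cmod_R.
  - intros e; exists (e / 2)%R; change (0 < Rabs (e / 2) < e)%R.
    pose proof (cond_pos e); rewrite Rabs_pos_eq; lra.
  - intros k a; exact (scal_R_Cmult k a).
  - exact Cmod_norm.
Qed.

Section Curves.
Context {K : AbsRing} {V : NormedModule K} (inj : K -> C) (val : V -> C).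
Hypothesis ext : scalar_extension inj val.

(** The parameter runs over [K] but the target is a module over C: the increment
    of the parameter acts through [inj].  Curves can thus be composed with
    complex differentiable maps even when [K] is R. *)
Definition curve_derivative {E : NormedModule C_AbsRing} (g : K -> E) (x : K) (l : E) : Prop :=
  forall e : posreal, locally x (fun y : K =>
    norm (minus (minus (g y) (g x)) (scal (inj (minus y x) : C_AbsRing) l)) <= e * abs (minus y x))%R.

Lemma val_minus (a b : V) : val (minus a b) = val a - val b.
Proof. unfold minus; rewrite (val_plus _ _ ext), (val_opp _ _ ext); reflexivity. Qed.

Lemma curve_derivative_val (f : K -> V) (x : K) (l : V) :
  is_derive f x l -> curve_derivative (E := CV) (fun y => val (f y)) x (val l).
Proof.
  intros H e.
  generalize (proj1 (is_derive_iff f x l) H e); apply filter_imp; intros y.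
  rewrite <- (Cmod_val _ _ ext), !val_minus, (val_scal _ _ ext); exact (fun h => h).
Qed.

Lemma curve_derivative_inj (x : K) : curve_derivative (E := CV) inj x (RtoC 1).
Proof.
  intros e; apply filter_forall; intros y.
  change (Cmod (inj y - inj x - inj (minus y x) * RtoC 1) <= e * abs (minus y x))%R.
  rewrite (inj_minus _ _ ext).
  replace (inj y - inj x - (inj y - inj x) * RtoC 1) with (RtoC 0) by ring.
  rewrite Cmod_0; apply Rmult_le_pos; [apply Rlt_le, cond_pos | apply abs_ge_0].
Qed.

Lemma curve_derivative_const {E : NormedModule C_AbsRing} (c : E) (x : K) :
  curve_derivative (fun _ => c) x zero.
Proof.
  intros e; apply filter_forall; intros y.
  rewrite (scal_zero_r (V := E)), !(minus_eq_zero (G := E)).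
  eapply Rle_trans; [apply Req_le, (norm_zero (V := E))|].
  apply Rmult_le_pos; [apply Rlt_le, cond_pos | apply abs_ge_0].
Qed.

Lemma curve_derivative_pair {E F : NormedModule C_AbsRing} (f : K -> E) (g : K -> F) (x : K)
    (l : E) (m : F) :
  curve_derivative f x l -> curve_derivative g x m ->
  curve_derivative (E := prod_NormedModule C_AbsRing E F) (fun y => (f y, g y)) x (l, m).
Proof.
  intros Hf Hg e.
  assert (He : (0 < e / 2)%R) by (pose proof (cond_pos e); lra).
  generalize (filter_and _ _ (Hf (mkposreal _ He)) (Hg (mkposreal _ He))).
  apply filter_imp; intros y [H1 H2]; simpl in H1, H2.
  replace (e * abs (minus y x))%R with (2 * (e / 2 * abs (minus y x)))%R by field.
  exact (norm_pair_le _ _ _ H1 H2).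
Qed.

Lemma curve_derivative_ext {E : NormedModule C_AbsRing} (f g : K -> E) (x : K) (l : E) :
  locally x (fun y => f y = g y) -> curve_derivative f x l -> curve_derivative g x l.
Proof.
  intros Hfg Hf e.
  assert (Hx : f x = g x) by exact (locally_singleton x _ Hfg).
  generalize (filter_and _ _ Hfg (Hf e)); apply filter_imp.
  intros y [E1 H]; rewrite <- E1, <- Hx; exact H.
Qed.

Lemma curve_derivative_lipschitz {E : NormedModule C_AbsRing} (g : K -> E) (x : K) (l : E) :
  curve_derivative g x l ->
  exists M : R, (0 < M)%R /\
    locally x (fun y => norm (minus (g y) (g x)) <= M * abs (minus y x))%R.
Proof.
  intros Hg; exists (norm l + 1)%R; split.
  { pose proof (norm_ge_0 l); lra. }
  generalize (Hg (mkposreal 1 Rlt_0_1)); apply filter_imp; intros y H; simpl in H.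
  set (r := minus (minus (g y) (g x)) (scal (inj (minus y x) : C_AbsRing) l)) in H.
  replace (minus (g y) (g x)) with (plus r (scal (inj (minus y x) : C_AbsRing) l)).
  2: { unfold r; unfold minus at 1; rewrite <- plus_assoc, plus_opp_l; apply plus_zero_r. }
  eapply Rle_trans; [apply norm_triangle|].
  assert (H' := norm_scal (inj (minus y x) : C_AbsRing) l).
  change (abs (inj (minus y x) : C_AbsRing)) with (Cmod (inj (minus y x))) in H'.
  rewrite (Cmod_inj _ _ ext) in H'; lra.
Qed.

(** A remainder that is o(w - g x) becomes o(y - x) along a map [g] that is
    Lipschitz at x.  It is stated for an arbitrary remainder because it is used
    with targets over C and with the plane over [K]. *)
Lemma domin_comp {K' : AbsRing} {W : NormedModule K'} (rho : W -> R) (g : K -> W) (x : K) (M : R) :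
  (forall e : posreal, locally (g x) (fun w => rho w <= e * norm (minus w (g x)))%R) ->
  (0 < M)%R ->
  locally x (fun y => norm (minus (g y) (g x)) <= M * abs (minus y x))%R ->
  forall e : posreal, locally x (fun y => rho (g y) <= e * abs (minus y x))%R.
Proof.
  intros Hrho HM Hg e.
  assert (He : (0 < e / M)%R) by (apply Rdiv_lt_0_compat; [apply cond_pos | exact HM]).
  destruct (locally_norm_le_locally _ _ (Hrho (mkposreal _ He))) as [d Hd]; simpl in Hd.
  assert (Hd' : (0 < d / M)%R) by (apply Rdiv_lt_0_compat; [apply cond_pos | exact HM]).
  assert (Hx : locally (T := AbsRing_UniformSpace K) x (fun y => abs (minus y x) < d / M)%R).
  { exists (mkposreal _ Hd'); intros y Hy; exact Hy. }
  generalize (filter_and _ _ Hg Hx); apply filter_imp; intros y [H1 H2].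
  assert (H3 : (norm (minus (g y) (g x)) < d)%R).
  { apply (Rle_lt_trans _ _ _ H1).
    apply Rlt_le_trans with (M * (d / M))%R; [apply Rmult_lt_compat_l; assumption|].
    apply Req_le; field; lra. }
  apply (Rle_trans _ _ _ (Hd _ H3)).
  apply Rle_trans with (e / M * (M * abs (minus y x)))%R.
  - apply Rmult_le_compat_l; [lra | exact H1].
  - apply Req_le; field; lra.
Qed.

Lemma curve_derivative_comp {E F : NormedModule C_AbsRing} (g : K -> E) (T : E -> F) (x : K)
    (l : E) (dT : E -> F) :
  filterdiff T (locally (g x)) dT -> curve_derivative g x l ->
  curve_derivative (fun y => T (g y)) x (dT l).
Proof.
  intros HT Hg e.
  destruct (curve_derivative_lipschitz g x l Hg) as [M [HM HgM]].
  destruct (linear_norm dT (proj1 HT)) as [N [HN HdT]].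
  assert (He : (0 < e / 2)%R) by (pose proof (cond_pos e); lra).
  assert (HeN : (0 < e / 2 / N)%R) by (apply Rdiv_lt_0_compat; assumption).
  assert (H1 := domin_comp (fun w => norm (minus (minus (T w) (T (g x))) (dT (minus w (g x)))))
    g x M (filterdiff_domin T (g x) dT HT) HM HgM (mkposreal _ He)).
  generalize (filter_and _ _ H1 (Hg (mkposreal _ HeN))); apply filter_imp.
  clear H1; intros y [H1 H2]; simpl in H1, H2.
  set (k := inj (minus y x) : C_AbsRing) in *.
  assert (H3 := HdT (minus (minus (g y) (g x)) (scal k l))).
  rewrite (linear_minus dT _ _ (proj1 HT)), (linear_scal dT (proj1 HT)) in H3.
  replace (minus (minus (T (g y)) (T (g x))) (scal k (dT l)))
    with (plus (minus (minus (T (g y)) (T (g x))) (dT (minus (g y) (g x))))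
               (minus (dT (minus (g y) (g x))) (scal k (dT l))))
    by (symmetry; apply minus_trans).
  eapply Rle_trans; [apply norm_triangle|].
  assert (N * norm (minus (minus (g y) (g x)) (scal k l)) <= e / 2 * abs (minus y x))%R; [|lra].
  apply Rle_trans with (N * (e / 2 / N * abs (minus y x)))%R.
  - apply Rmult_le_compat_l; [lra | exact H2].
  - apply Req_le; field; lra.
Qed.

Lemma curve_derivative_fst {E F : NormedModule C_AbsRing} (g : K -> E * F) (x : K) (l : E * F) :
  curve_derivative (E := prod_NormedModule C_AbsRing E F) g x l ->
  curve_derivative (fun y => fst (g y)) x (fst l).
Proof.
  exact (curve_derivative_comp g fst x l fst (filterdiff_linear _ is_linear_fst)).
Qed.

Lemma curve_derivative_snd {E F : NormedModule C_AbsRing} (g : K -> E * F) (x : K) (l : E * F) :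
  curve_derivative (E := prod_NormedModule C_AbsRing E F) g x l ->
  curve_derivative (fun y => snd (g y)) x (snd l).
Proof.
  exact (curve_derivative_comp g snd x l snd (filterdiff_linear _ is_linear_snd)).
Qed.

Lemma curve_derivative_unique (g : K -> C) (x : K) (l m : C) :
  curve_derivative (E := CV) g x l -> curve_derivative (E := CV) g x m -> l = m.
Proof.
  intros Hl Hm.
  destruct (Req_dec (Cmod (l - m)) 0) as [H0|H0].
  { replace l with (l - m + m) by ring; rewrite (Cmod_eq_0 _ H0); ring. }
  assert (Hp : (0 < Cmod (l - m) / 3)%R) by (pose proof (Cmod_ge_0 (l - m)); lra).
  destruct (filter_and _ _ (Hl (mkposreal _ Hp)) (Hm (mkposreal _ Hp))) as [d Hd].
  destruct (small_scalar _ _ ext d) as [k [Hk0 Hkd]].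
  assert (Ek : minus (plus x k) x = k).
  { unfold minus; rewrite (plus_comm x), <- plus_assoc.
    exact (eq_trans (f_equal (plus k) (plus_opp_r x)) (plus_zero_r k)). }
  destruct (Hd (plus x k)) as [H1 H2].
  { change (abs (minus (plus x k) x) < d)%R; rewrite Ek; exact Hkd. }
  simpl in H1, H2; rewrite Ek in H1, H2.
  change (Cmod (g (plus x k) - g x - inj k * l) <= Cmod (l - m) / 3 * abs k)%R in H1.
  change (Cmod (g (plus x k) - g x - inj k * m) <= Cmod (l - m) / 3 * abs k)%R in H2.
  set (dg := g (plus x k) - g x) in *.
  assert (H3 := Cmod_triangle (dg - inj k * m) (- (dg - inj k * l))).
  replace (dg - inj k * m + - (dg - inj k * l)) with (inj k * (l - m)) in H3 by ring.
  rewrite Cmod_opp, Cmod_mult, (Cmod_inj _ _ ext) in H3.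
  exfalso; nra.
Qed.

(** Chain rule for a function of two variables in [K].  The components of [phi]
    are differentiated after the embedding in C, as the chain rule for the
    transformation delivers them; the increment of [f] is compared with complex
    multiples of its partial derivatives, so a and b are complex numbers. *)
Lemma curve_derivative_2d (f : K * K -> V) (phi : K -> K * K) (x : K) (lf : K * K -> V) (a b : C) :
  filterdiff (U := prod_NormedModule K (AbsRing_NormedModule K) (AbsRing_NormedModule K))
    f (locally (phi x)) lf ->
  curve_derivative (E := CV) (fun y => inj (fst (phi y))) x a ->
  curve_derivative (E := CV) (fun y => inj (snd (phi y))) x b ->
  curve_derivative (E := CV) (fun y => val (f (phi y))) x
    (a * val (lf (one, zero)) + b * val (lf (zero, one))).
Proof.
  intros Hf Ha Hb e.
  set (K2 := prod_NormedModule K (AbsRing_NormedModule K) (AbsRing_NormedModule K)) in *.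
  set (A := val (lf (one, zero))); set (B := val (lf (zero, one))).
  assert (Hlf : forall h k : K, val (lf (h, k)) = inj h * A + inj k * B).
  { intros h k; unfold A, B.
    rewrite <- !(val_scal _ _ ext), <- (val_plus _ _ ext), <- !(linear_scal lf (proj1 Hf)),
      <- (linear_plus lf (proj1 Hf)).
    do 2 f_equal; change ((h, k) = (plus (mult h one) (mult k zero), plus (mult h zero) (mult k one))).
    rewrite !mult_one_r, !mult_zero_r, plus_zero_r, plus_zero_l; reflexivity. }
  destruct (curve_derivative_lipschitz _ x a Ha) as [M1 [HM1 HL1]].
  destruct (curve_derivative_lipschitz _ x b Hb) as [M2 [HM2 HL2]].
  assert (HL : locally x (fun y =>
    norm (minus (phi y : K2) (phi x)) <= 2 * (M1 + M2) * abs (minus y x))%R).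
  { generalize (filter_and _ _ HL1 HL2); apply filter_imp; intros y [h1 h2].
    change (Cmod (inj (fst (phi y)) - inj (fst (phi x))) <= M1 * abs (minus y x))%R in h1.
    change (Cmod (inj (snd (phi y)) - inj (snd (phi x))) <= M2 * abs (minus y x))%R in h2.
    rewrite <- (inj_minus _ _ ext), (Cmod_inj _ _ ext) in h1, h2.
    rewrite Rmult_assoc.
    assert (Hab := abs_ge_0 (minus y x)).
    apply norm_pair_le; [apply (Rle_trans _ _ _ h1) | apply (Rle_trans _ _ _ h2)]; nra. }
  assert (He : (0 < e / 2)%R) by (pose proof (cond_pos e); lra).
  set (n := (2 * (Cmod A + Cmod B + 1))%R).
  assert (HA := Cmod_ge_0 A); assert (HB := Cmod_ge_0 B).
  assert (Hn : (0 < n)%R) by (unfold n; lra).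
  assert (Hen : (0 < e / n)%R) by (apply Rdiv_lt_0_compat; [apply cond_pos | exact Hn]).
  assert (H1 := domin_comp (W := K2)
    (fun w => norm (minus (minus (f w) (f (phi x))) (lf (minus w (phi x)))))
    phi x (2 * (M1 + M2))%R (filterdiff_domin f (phi x) lf Hf) ltac:(lra) HL (mkposreal _ He)).
  generalize (filter_and _ _ H1 (filter_and _ _ (Ha (mkposreal _ Hen)) (Hb (mkposreal _ Hen)))).
  apply filter_imp; clear H1; intros y [H1 [H2 H3]]; simpl in H1, H2, H3.
  rewrite <- (Cmod_val _ _ ext), !val_minus in H1.
  replace (minus (phi y : K2) (phi x))
    with (minus (fst (phi y)) (fst (phi x)), minus (snd (phi y)) (snd (phi x))) in H1
    by reflexivity.
  rewrite Hlf, !(inj_minus _ _ ext) in H1.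
  set (k := inj (minus y x)) in *.
  change (Cmod (inj (fst (phi y)) - inj (fst (phi x)) - k * a) <= e / n * abs (minus y x))%R in H2.
  change (Cmod (inj (snd (phi y)) - inj (snd (phi x)) - k * b) <= e / n * abs (minus y x))%R in H3.
  change (Cmod (val (f (phi y)) - val (f (phi x)) - k * (a * A + b * B)) <= e * abs (minus y x))%R.
  set (d1 := inj (fst (phi y)) - inj (fst (phi x))) in *.
  set (d2 := inj (snd (phi y)) - inj (snd (phi x))) in *.
  set (df := val (f (phi y)) - val (f (phi x))) in *.
  replace (df - k * (a * A + b * B))
    with ((df - (d1 * A + d2 * B)) + ((d1 - k * a) * A + (d2 - k * b) * B)) by ring.
  eapply Rle_trans; [apply Cmod_triangle|].
  assert (H4 := Cmod_triangle ((d1 - k * a) * A) ((d2 - k * b) * B)).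
  rewrite !Cmod_mult in H4.
  set (r := abs (minus y x)) in *.
  assert (H5 := Rmult_le_compat_r _ _ _ HA H2).
  assert (H6 := Rmult_le_compat_r _ _ _ HB H3).
  assert (H7 : (e / n * r * (Cmod A + Cmod B) <= e / 2 * r)%R).
  { replace (e / 2 * r)%R with (e / n * r * (Cmod A + Cmod B + 1))%R
      by (unfold n; field; lra).
    apply Rmult_le_compat_l; [|lra].
    apply Rmult_le_pos; [lra | apply abs_ge_0]. }
  lra.
Qed.

(** The image under [T] of a curve on the graph of (u, v) lies on the graph of
    (u', v'), so its tangent vector dT h is tangent to that graph. *)
Lemma related_derivatives (M : C4 -> Prop) (T : C4 -> C4) (D D' : K * K -> Prop)
    (u v u' v' : K * K -> V) (phi : K * K -> K * K) (c : K -> K * K) (s : K)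
    (dT : C4 -> C4) (lu lv : K * K -> V) (h : C4) :
  related inj val M T D u v D' u' v' phi ->
  locally s (fun y => D (c y)) ->
  let q y : C4 := ((inj (fst (c y)), inj (snd (c y))), (val (u (c y)), val (v (c y)))) in
  filterdiff T (locally (q s)) dT ->
  filterdiff u' (locally (phi (c s))) lu ->
  filterdiff v' (locally (phi (c s))) lv ->
  curve_derivative q s h ->
  let '((a, b), (du, dv)) := dT h in
  du = a * val (lu (one, zero)) + b * val (lu (zero, one)) /\
  dv = a * val (lv (one, zero)) + b * val (lv (zero, one)).
Proof.
  intros Hrel Hc q HT Hu Hv Hq.
  assert (H := curve_derivative_comp q T s h dT HT Hq).
  assert (H' : curve_derivative (E := C4) (fun y =>
     ((inj (fst (phi (c y))), inj (snd (phi (c y)))),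
      (val (u' (phi (c y))), val (v' (phi (c y)))))) s (dT h)).
  { refine (curve_derivative_ext _ _ s _ _ H).
    revert Hc; apply filter_imp; intros y Hy.
    exact (proj2 (proj2 (Hrel _ Hy))). }
  destruct (dT h) as [[a b] [du dv]].
  assert (H1 := curve_derivative_fst (E := C2) (F := C2) _ _ _ H').
  assert (H2 := curve_derivative_snd (E := C2) (F := C2) _ _ _ H').
  assert (Ha := curve_derivative_fst (E := CV) (F := CV) _ _ _ H1).
  assert (Hb := curve_derivative_snd (E := CV) (F := CV) _ _ _ H1).
  assert (Hdu := curve_derivative_fst (E := CV) (F := CV) _ _ _ H2).
  assert (Hdv := curve_derivative_snd (E := CV) (F := CV) _ _ _ H2).
  split.
  - exact (curve_derivative_unique _ _ _ _ Hdu
      (curve_derivative_2d u' (fun y => phi (c y)) s lu a b Hu Ha Hb)).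
  - exact (curve_derivative_unique _ _ _ _ Hdv
      (curve_derivative_2d v' (fun y => phi (c y)) s lv a b Hv Ha Hb)).
Qed.
End Curves.

(** * The two systems *)

(** The three equations are linear in A = u'_x', P = v'_x' and Q = v'_t'; the
    coefficient X v_x / 2 = X u x / 2 of the first two does not vanish. *)
Lemma primed_from_unprimed (eps x u v t ux vx vt A P Q : C) :
  eps <> RtoC 0 -> x <> RtoC 0 -> u <> RtoC 0 ->
  let X := Cexp (t + v / RtoC 2) in
  let U := RtoC 4 * eps * Cexp (- (v + RtoC 2 * t)) / (u * (x * x)) in
  vx = u * x -> vt = x / u * ux ->
  - U * (vx + ux / u + RtoC 2 / x) = X * (vx / RtoC 2) * A ->
  RtoC 2 * (eps / x) = X * (vx / RtoC 2) * P ->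
  - RtoC 2 = X * (RtoC 1 + vt / RtoC 2) * P + Q ->
  U <> RtoC 0 /\ P = X * U /\ Q = eps * (X / U) * A + RtoC 2 * (eps - RtoC 1).
Proof.
  intros He Hx Hu X U -> -> EA EP EQ.
  assert (H2 : RtoC 2 <> RtoC 0) by (apply RtoC_neq_0; lra).
  assert (H4 : RtoC 4 = RtoC 2 * RtoC 2) by (rewrite <- RtoC_mult; f_equal; ring).
  assert (HX : X <> RtoC 0) by apply Cexp_neq_0.
  (* X X = e^(2 t + v), so every exponential is rational in X. *)
  assert (EE : Cexp (- (v + RtoC 2 * t)) = / (X * X)).
  { assert (H : Cexp (- (v + RtoC 2 * t)) * (X * X) = RtoC 1).
    { unfold X; rewrite <- !Cexp_plus, <- Cexp_0; f_equal; field; exact H2. }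
    replace (/ (X * X)) with (Cexp (- (v + RtoC 2 * t)) * (X * X) * / (X * X))
      by (rewrite H; ring).
    field; exact HX. }
  assert (EU : U = RtoC 4 * eps / (X * X * (u * (x * x)))).
  { unfold U; rewrite EE; field; repeat split; assumption. }
  clearbody U; subst U; rewrite H4 in *; clear H4 EE.
  clearbody X.
  assert (EP' : P = RtoC 2 * RtoC 2 * eps / (X * (u * (x * x)))).
  { replace P with (X * (u * x / RtoC 2) * P * (RtoC 2 / (X * (u * x))))
      by (field; repeat split; assumption).
    rewrite <- EP; field; repeat split; assumption. }
  assert (EA' : A = X * (u * x / RtoC 2) * A * (RtoC 2 / (X * (u * x))))
    by (field; repeat split; assumption).
  rewrite <- EA in EA'.
  assert (EQ' : Q = - RtoC 2 - X * (RtoC 1 + x / u * ux / RtoC 2) * P) by (rewrite EQ; ring).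
  rewrite EQ', EA', EP'.
  split; [|split].
  - unfold Cdiv; repeat apply Cmult_neq_0; try assumption.
    intros H; apply C1_nz.
    rewrite <- (Cinv_r (X * X * (u * (x * x)))), H; [ring|].
    repeat apply Cmult_neq_0; assumption.
  - field; repeat split; assumption.
  - field; repeat split; assumption.
Qed.

Lemma transforms_over_transf {K : AbsRing} {V : NormedModule K} (inj : K -> C) (val : V -> C)
    (eps : C) (Omega : C -> Prop) (L : C -> C) :
  scalar_extension inj val -> eps <> RtoC 0 -> log_branch Omega L ->
  transforms_over inj val (transf_domain Omega) (transf eps L)
    (primed_system eps) unprimed_system.
Proof.
  intros ext He HL D D' u v u' v' phi HD HD' Du Dv Du' Dv' Hrel Hsat [x t] Hp.
  destruct (Hsat _ Hp) as (ux & ut & vx & vt & Hux & Hut & Hvx & Hvt & Hu0 & Evx & Evt).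
  destruct (Hrel _ Hp) as (HM & HD'p & HT).
  destruct (Du' _ HD'p) as [lu Hlu]; destruct (Dv' _ HD'p) as [lv Hlv].
  set (q := ((inj x, inj t), (val (u (x, t)), val (v (x, t)))) : C4).
  assert (HdT := filterdiff_transf eps Omega L q HL HM).
  destruct (is_derive_log_branch _ _ _ HL (proj1 HM)) as [Hx0 _].
  destruct (HD _ Hp) as [r Hr].
  (* G1 and G2: tangents to the graph of (u, v) over the two coordinate lines
     through (x, t). *)
  assert (G1 : curve_derivative inj (E := C4)
    (fun y => ((inj y, inj t), (val (u (y, t)), val (v (y, t))))) x
    ((RtoC 1, RtoC 0), (val ux, val vx))).
  { apply (curve_derivative_pair inj (E := C2) (F := C2));
      apply (curve_derivative_pair inj (E := CV) (F := CV)).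
    - exact (curve_derivative_inj inj val ext x).
    - exact (curve_derivative_const inj (E := CV) (inj t) x).
    - exact (curve_derivative_val inj val ext _ _ _ Hux).
    - exact (curve_derivative_val inj val ext _ _ _ Hvx). }
  assert (G2 : curve_derivative inj (E := C4)
    (fun y => ((inj x, inj y), (val (u (x, y)), val (v (x, y))))) t
    ((RtoC 0, RtoC 1), (val ut, val vt))).
  { apply (curve_derivative_pair inj (E := C2) (F := C2));
      apply (curve_derivative_pair inj (E := CV) (F := CV)).
    - exact (curve_derivative_const inj (E := CV) (inj x) t).
    - exact (curve_derivative_inj inj val ext t).
    - exact (curve_derivative_val inj val ext _ _ _ Hut).
    - exact (curve_derivative_val inj val ext _ _ _ Hvt). }
  assert (E1 := related_derivatives inj val ext _ _ D D' u v u' v' phi (fun y => (y, t)) x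
    _ lu lv _ Hrel (ex_intro _ r (fun y Hy => Hr (y, t) (conj Hy (ball_center t r))))
    HdT Hlu Hlv G1).
  assert (E2 := related_derivatives inj val ext _ _ D D' u v u' v' phi (fun y => (x, y)) t
    _ lu lv _ Hrel (ex_intro _ r (fun y Hy => Hr (x, y) (conj (ball_center x r) Hy)))
    HdT Hlu Hlv G2).
  simpl in E1, E2, HT, Hx0, Hu0, Evx, Evt.
  destruct E1 as [EA EP]; destruct E2 as [_ EQ].
  injection HT as HX _ HU _.
  (* The zeros of K as a ring and as a module over itself are convertible but not
     syntactically equal; naming the two vectors identifies them. *)
  set (e1 := (one : K, zero : K)) in *; set (e2 := (zero : K, one : K)) in *.
  exists (lu e1), (lu e2), (lv e1), (lv e2).
  split; [exact (filterdiff_partial1 _ _ _ Hlu)|].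
  split; [exact (filterdiff_partial2 _ _ _ Hlu)|].
  split; [exact (filterdiff_partial1 _ _ _ Hlv)|].
  split; [exact (filterdiff_partial2 _ _ _ Hlv)|].
  unfold primed_system; rewrite <- HX, <- HU.
  apply (primed_from_unprimed _ _ _ _ _ (val ux) (val vx) (val vt)); try assumption.
  - refine (eq_trans _ (eq_trans EA _)); unfold Cdiv; ring.
  - refine (eq_trans _ (eq_trans EP _)); unfold Cdiv; ring.
  - refine (eq_trans _ (eq_trans EQ _)); unfold Cdiv; ring.
Qed.

Theorem mainTheorem9 :
  forall (eps : C) (Omega : C -> Prop) (L : C -> C),
    eps <> RtoC 0 ->
    log_branch Omega L ->
    point_transformation (transf_domain Omega) (transf eps L)
      (primed_system eps) unprimed_system.
Proof.
  intros eps Omega L He HL.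
  split; [exact (open_transf_domain Omega L HL)|].
  split; [exact (nondegenerate_transf eps Omega L He HL)|].
  split.
  - exact (transforms_over_transf _ _ eps Omega L scalar_extension_C He HL).
  - exact (transforms_over_transf _ _ eps Omega L scalar_extension_R He HL).
Qed.
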